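(* Let $n\ge 1$ and let $H(K)$ be the knot (link) invariant associated to the fundamental representation of the Lie algebra $A_n$. Then $H$ satisfies the following skein relation: $$q^{\frac{n+1}{2}}H(L_+)-q^{-\frac{n+1}{2}}H(L_-)=\bigl(q^{\frac12}-q^{-\frac12}\bigr)H(L_0),$$ where $L_+$, $L_-$, $L_0$ are oriented link diagrams that are identical except at one place, where $L_+$ has a positive crossing, $L_-$ a negative crossing, and $L_0$ two uncrossed parallel strands.
   Context: $q=e^{2\pi i/(k+n+1)}$ with level $k$, $k+n+1\ne0$, and $q^r:=e^{2\pi i r/(k+n+1)}$ for $r\in\mathbb{Q}$. All indices run over $\{0,1,\dots,n\}$. Braiding matrix: $\mathcal{B}$ acts on the space with basis $\mathcal{J}_{a,b}$ ($0\le a,b\le n$) by $\mathcal{B}\mathcal{J}_{c,d}=\sum_{a,b}\mathcal{B}^{ab}_{cd}\mathcal{J}_{a,b}$, where $$\mathcal{B}\mathcal{J}_{a,b}=\begin{cases} q^{-\frac{n}{2(n+1)}}\mathcal{J}_{a,b}, & a=b,\\ q^{\frac{1}{2(n+1)}}\mathcal{J}_{b,a}, & a>b,\\ q^{\frac{1}{2(n+1)}}\mathcal{J}_{b,a}+\bigl(q^{-\frac{n}{2(n+1)}}-q^{\frac{n+2}{2(n+1)}}\bigr)\mathcal{J}_{a,b}, & a<b.\end{cases}$$ $(\mathcal{B}^{-1})^{ab}_{cd}$ denotes the entries of the inverse operator, with the same index convention. Fusion matrix: $\mathcal{M}_{ab}=q^{\frac{n-2a}{4}}$ if $a+b=n$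 and $0$ otherwise; $\mathcal{M}^{ab}$ are the entries of the inverse matrix (here $\mathcal{M}^{ab}=\mathcal{M}_{ab}$). Bracket: a link diagram in the plane is decomposed, with respect to a height function, into annihilations of pairs of strands (tensor $\mathcal{M}_{ab}$), creations of pairs of strands (tensor $\mathcal{M}^{ab}$), vertical strands (tensor $\delta^a_b$), and crossings of two vertically running strands (tensor $\mathcal{B}^{ab}_{cd}$ or $(\mathcal{B}^{-1})^{ab}_{cd}$, the upper indices labelling the two ends on the annihilation side and the lower indices the two ends on the creation side). A crossing carries $\mathcal{B}$ if it is negative when both strands are given the same vertical direction, and $\mathcal{B}^{-1}$ if it is positive when both strands are given the same vertical direction. The number $\langle K\rangle$ is the full contraction of all these tensors, each arc between elementary pieces carrying an index in $\{0,\dots,n\}$ that is summed over. Invariant: for an oriented diagram $K$, $H(K)=a^{-\omega(K)}\langle K\rangle$, where $a=q^{\frac{n(n+2)}{2(n+1)}}$ and $\omega(K)$ is the writhe of $K$ (the sum of the signs of its crossings). In the skein triple, the two strands at the distinguished place both run in the same vertical direction, so that $\langle L_+\rangle$, $\langle L_-\rangle$ and $\langle L_0\rangle$ have there the tensor $\mathcal{B}^{-1}$, $\mathcal{B}$ and the identity $\mathcal{I}$, respectively, and agree elsewhere. *)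

(* Defs.v *)
From HB Require Import structures.
From mathcomp Require Import all_boot all_order all_algebra.
From mathcomp Require Import reals sequences exp trigo.
From mathcomp.real_closed Require Export complex.

Set Implicit Arguments.
Unset Strict Implicit.
Unset Printing Implicit Defensive.

Import Order.TTheory GRing.Theory Num.Theory.

Local Open Scope ring_scope.
Local Open Scope complex_scope.

(* A diagram is a stack of horizontal layers, listed from the creation side to
   the annihilation side; a layer is the left-to-right list of its elementary
   pieces.  A strand direction is a boolean: [true] means running from the
   creation side towards the annihilation side. *)
Inductive piece : Type :=
  (* [d] is the direction of the left leg; the right leg has direction [~~ d] *)
  | Annihilation of bool
  | Creation of bool
  | Vertical of bool
  (* [Crossing s d1 d2]: [s] says whether the crossing is positive when both
     strands are given the same vertical direction; [d1] (resp. [d2]) is the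
     direction of the strand whose creation-side end is on the left (resp. on
     the right). *)
  | Crossing of bool & bool & bool.

Definition layer := seq piece.

Definition creation_ends (p : piece) : seq bool :=
  match p with
  | Annihilation d => [:: d; ~~ d]
  | Creation _ => [::]
  | Vertical d => [:: d]
  | Crossing _ d1 d2 => [:: d1; d2]
  end.

Definition annihilation_ends (p : piece) : seq bool :=
  match p with
  | Annihilation _ => [::]
  | Creation d => [:: d; ~~ d]
  | Vertical d => [:: d]
  | Crossing _ d1 d2 => [:: d2; d1]
  end.

Definition layer_in (l : layer) : seq bool := flatten (map creation_ends l).
Definition layer_out (l : layer) : seq bool := flatten (map annihilation_ends l).

Fixpoint composable (x : seq bool) (K : seq layer) (y : seq bool) : bool :=
  match K with
  | [::] => x == y
  | l :: K' => (layer_in l == x) && composable (layer_out l) K' y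
  end.

Record link_diagram := LinkDiagram {
  layers :> seq layer;
  layers_closed : composable [::] layers [::]
}.

(* Reversing one of its two strands changes the sign of a crossing. *)
Definition piece_sign (p : piece) : int :=
  match p with
  | Crossing s d1 d2 => if s == (d1 == d2) then 1 else -1
  | _ => 0
  end.

Definition writhe (K : link_diagram) : int :=
  \sum_(p <- flatten (layers K)) piece_sign p.

Definition skein_triple (Lp Lm L0 : link_diagram) : Prop :=
  exists (d : bool) (before after : seq layer) (left right : layer),
    let insert_at_place (ps : seq piece) : seq layer :=
      before ++ [:: left ++ ps ++ right] ++ after in
    [/\ layers Lp = insert_at_place [:: Crossing true d d],
        layers Lm = insert_at_place [:: Crossing false d d]
      & layers L0 = insert_at_place [:: Vertical d; Vertical d]].

Section Invariant.
Variable R : realType.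
Local Notation C := R[i].

Definition cexp (z : C) : C :=
  let: x +i* y := z in (expR x)%:C * (cos y +i* sin y).

Variables (k : C) (n : nat).

Definition qpow (r : rat) : C :=
  cexp (2 * (pi : R)%:C * (0 +i* 1) * ratr r / (k + n%:R + 1)).

Local Notation index := 'I_n.+1.

Definition J (a b : index) : 'M[C]_n.+1 := delta_mx a b.

Definition braid_image (a b : index) : 'M[C]_n.+1 :=
  if a == b then qpow (- (n%:R / (2 * n.+1%:R))) *: J a b
  else if (b < a)%N then qpow (1 / (2 * n.+1%:R)) *: J b a
  else qpow (1 / (2 * n.+1%:R)) *: J b a
       + (qpow (- (n%:R / (2 * n.+1%:R))) - qpow (n.+2%:R / (2 * n.+1%:R)))
           *: J a b.

(* The matrix of the braiding acting on column vectors: its entry at row (a, b)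
   and column (c, d) is the coefficient of [J a b] in the image of [J c d]. *)
Definition braid_mx : 'M[C]_#|{: index * index}| :=
  \matrix_(i, j) braid_image (enum_val j).1 (enum_val j).2
                             (enum_val i).1 (enum_val i).2.

Definition braid (a b c d : index) : C :=
  braid_mx (enum_rank (a, b)) (enum_rank (c, d)).

Definition braid_inv (a b c d : index) : C :=
  invmx braid_mx (enum_rank (a, b)) (enum_rank (c, d)).

Definition fusion_mx : 'M[C]_n.+1 :=
  \matrix_(a, b) if (a + b == n)%N then qpow ((n%:R - 2 * a%:R) / 4) else 0.

(* [x] labels the creation-side ends and [y] the annihilation-side ends. *)
Definition piece_tensor (p : piece) (x y : seq index) : C :=
  match p, x, y with
  | Annihilation _, [:: a; b], [::] => fusion_mx a b
  | Creation _, [::], [:: a; b] => invmx fusion_mx a b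
  | Vertical _, [:: b], [:: a] => (a == b)%:R
  | Crossing s _ _, [:: c; d], [:: a; b] =>
      if s then braid_inv a b c d else braid a b c d
  | _, _, _ => 0
  end.

Fixpoint layer_tensor (l : layer) (x y : seq index) : C :=
  match l with
  | [::] => (nilp x && nilp y)%:R
  | p :: l' =>
      let i := size (creation_ends p) in
      let o := size (annihilation_ends p) in
      piece_tensor p (take i x) (take o y) *
      layer_tensor l' (drop i x) (drop o y)
  end.

(* Sum over all labellings of the arcs between consecutive layers, with the
   labels [x] and [y] of the two boundary levels fixed. *)
Fixpoint contraction (K : seq layer) (x y : seq index) : C :=
  match K with
  | [::] => (x == y)%:R
  | l :: K' =>
      \sum_(z : (size (layer_out l)).-tuple index)
        layer_tensor l x z * contraction K' z y
  end.

Definition bracket (K : link_diagram) : C := contraction (layers K) [::] [::].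

Definition framing_factor : C := qpow (n%:R * n.+2%:R / (2 * n.+1%:R)).

Definition H (K : link_diagram) : C :=
  framing_factor ^ (- writhe K) * bracket K.

End Invariant.

(* Main.v *)
Require Import Defs.
From mathcomp Require Import all_boot all_order all_algebra.
From mathcomp Require Import reals.
From mathcomp Require Import exp trigo ring.

Import GRing.Theory Num.Theory.
Local Open Scope ring_scope.
Local Open Scope complex_scope.

(** Write [s] for q^(1/(2(n+1))), so that q^(1/2) = s^(n+1) and the framing
    factor is a = s^(n(n+2)).

    The rescaled braiding s^-1 B satisfies the Hecke relation: on each plane
    spanned by J_cd and J_dc with c <> d its eigenvalues are q^(-1/2) and
    - q^(1/2), and on J_cc it is multiplication by q^(-1/2).  Hence
      B^2 = s^2 + gamma B   with   gamma = s (q^(-1/2) - q^(1/2))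
    ([braid_hecke]).  Multiplying by B^-1 turns this into the local skein
    relation s B^-1 - s^-1 B = q^(1/2) - q^(-1/2) ([braid_inv_skein]).

    The bracket is a full contraction, hence linear in the tensor placed at
    the distinguished place, so that the three brackets satisfy the same
    relation ([bracket_skein]).  What remains is the normalisation by the
    writhe: w(L+) = w(L0) + 1 and w(L-) = w(L0) - 1, and since
    (n+1)^2 = 1 + n(n+2) we have q^((n+1)/2) = s a ([framing_exponent]); the
    outer factors q^(+-(n+1)/2) of the relation therefore absorb the extra
    a^(-+1) and leave exactly s^(+-1). *)

(** * Powers of q *)

Lemma cexpD (R : realType) (z w : R[i]) : cexp (z + w) = cexp z * cexp w.
Proof.
case: z w => [x y] [x' y']; rewrite /cexp /= expRD cosD sinD.
by apply/eqP; rewrite eq_complex /=; apply/andP; split; apply/eqP; ring.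
Qed.

Lemma cexp0 (R : realType) : cexp (0 : R[i]) = 1.
Proof.
rewrite /cexp /= expR0 cos0 sin0.
by apply/eqP; rewrite eq_complex /= !(mulr0, mul0r, mulr1, subr0, addr0) !eqxx.
Qed.

Section QuantumPowers.
Variables (R : realType) (k : R[i]) (n : nat).

Lemma qpowD r s : qpow k n (r + s) = qpow k n r * qpow k n s.
Proof. by rewrite /qpow (rmorphD (@ratr R[i])) mulrDr mulrDl cexpD. Qed.

Lemma qpow0 : qpow k n 0 = 1.
Proof. by rewrite /qpow (rmorph0 (@ratr R[i])) mulr0 mul0r cexp0. Qed.

Lemma qpow_neq0 r : qpow k n r != 0.
Proof.
have /eqP : qpow k n r * qpow k n (- r) = 1 by rewrite -qpowD subrr qpow0.
by apply: contraTneq => ->; rewrite mul0r eq_sym oner_eq0.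
Qed.

Lemma qpowN r : qpow k n (- r) = (qpow k n r)^-1.
Proof.
apply: (mulfI (qpow_neq0 r)).
by rewrite -qpowD subrr qpow0 mulfV ?qpow_neq0.
Qed.

End QuantumPowers.

(** * The Hecke relation for the braiding *)

Section Braiding.
Variables (R : realType) (k : R[i]) (n : nat).
Local Notation index := 'I_n.+1.
Local Notation s := (qpow k n (1 / (2 * n.+1%:R))).
Local Notation alpha := (qpow k n (- (n%:R / (2 * n.+1%:R)))).
Local Notation gamma := (alpha - qpow k n (n.+2%:R / (2 * n.+1%:R))).
Local Notation B := (braid_mx k n).

(** The braiding maps J_cd to [diag_coef c d] J_cd + [swap_coef c d] J_dc; the
    value of [swap_coef] on the diagonal is 0 so that this single formula
    covers the case c = d, where the two vectors coincide. *)
Definition diag_coef (a b : index) : R[i] :=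
  if a == b then alpha else if (b < a)%N then 0 else gamma.

Definition swap_coef (a b : index) : R[i] := if a == b then 0 else s.

Lemma braid_mxE (a b c d : index) :
  B (enum_rank (a, b)) (enum_rank (c, d)) =
  diag_coef c d * ((a, b) == (c, d))%:R + swap_coef c d * ((a, b) == (d, c))%:R.
Proof.
rewrite !mxE !enum_rankK /= /braid_image /diag_coef /swap_coef !xpair_eqE.
case: eqVneq => [<-|_]; first by rewrite !mxE mul0r addr0.
by case: ifP => _; rewrite !mxE ?mul0r ?add0r // addrC.
Qed.

(** A column of the braiding has at most two nonzero entries, so that any
    contraction against it collapses. *)
Lemma sum_braid_mx (F : index * index -> R[i]) (c d : index) :
  \sum_p F p * B (enum_rank p) (enum_rank (c, d)) =
  diag_coef c d * F (c, d) + swap_coef c d * F (d, c).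
Proof.
have sum1 (q : index * index) : \sum_p F p * (p == q)%:R = F q.
  rewrite (bigD1 q) //= eqxx mulr1 big1 ?addr0 // => p /negPf->.
  by rewrite mulr0.
rewrite -(sum1 (c, d)) -(sum1 (d, c)) !mulr_sumr -big_split /=.
by apply: eq_bigr => -[a b] _; rewrite braid_mxE; ring.
Qed.

Lemma half_exponent : (n.+1%:R / (2 * n.+1%:R) : rat) = 1 / 2.
Proof. by field; rewrite nat1r pnatr_eq0. Qed.

Lemma gammaE : gamma = s * (qpow k n (- (1 / 2)) - qpow k n (1 / 2)).
Proof.
rewrite mulrBr -!qpowD -half_exponent -[in RHS]mulNr -!mulrDl -mulNr.
by congr (qpow _ _ (_ / _) - qpow _ _ (_ / _)); rewrite -?natr1; ring.
Qed.

Lemma alphaM : alpha * qpow k n (n.+2%:R / (2 * n.+1%:R)) = s ^+ 2.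
Proof.
rewrite expr2 -!qpowD -mulNr -!mulrDl.
by congr (qpow _ _ (_ / _)); rewrite -?natr1; ring.
Qed.

(** By the collapse of the columns, the coefficients of B^2 J_cd only involve
    (c, d) and (d, c).  For c <> d exactly one of the two diagonal coefficients
    is [gamma] and the other one 0, which makes the plane of J_cd and J_dc
    satisfy the quadratic equation; for c = d the equation reads
    alpha^2 = s^2 + gamma alpha, that is [alphaM]. *)
Lemma braid_hecke : B *m B = (s ^+ 2)%:M + gamma *: B.
Proof.
apply/matrixP => i j.
rewrite -(enum_valK i) -(enum_valK j).
case: (enum_val i) (enum_val j) => a b [c d] {i j}.
rewrite mxE (reindex (@enum_rank (index * index)%type)) /=; last first.
  by apply: onW_bij; exact: enum_rank_bij.
rewrite (sum_braid_mx (fun p => B (enum_rank (a, b)) (enum_rank p))).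
have -> : ((s ^+ 2)%:M + gamma *: B) (enum_rank (a, b)) (enum_rank (c, d)) =
    s ^+ 2 * ((a, b) == (c, d))%:R
    + gamma * B (enum_rank (a, b)) (enum_rank (c, d)).
  rewrite mxE [X in X + _]mxE [X in _ + X]mxE (inj_eq enum_rank_inj).
  by rewrite -(mulr_natr (s ^+ 2)).
rewrite !braid_mxE /diag_coef /swap_coef -alphaM.
case: eqVneq => [<-|]; first by ring.
rewrite alphaM -val_eqE /=.
by case: ltngtP => //= _ _; ring.
Qed.

(** The Hecke relation exhibits B^-1 as s^-2 (B - gamma); in particular B is
    invertible, so that [invmx B] is its true inverse. *)
Lemma braid_inv_skein :
  s *: invmx B - s^-1 *: B = (qpow k n (1 / 2) - qpow k n (- (1 / 2)))%:M.
Proof.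
have s_neq0 : s != 0 := qpow_neq0 R k n _.
pose B' := s ^- 2 *: (B - gamma%:M).
have BB' : B *m B' = 1%:M.
  rewrite -scalemxAr mulmxBr braid_hecke mul_mx_scalar addrK.
  by rewrite scale_scalar_mx mulVf ?expf_neq0.
have -> : invmx B = B'.
  by rewrite -[LHS]mulmx1 -BB' mulKmx //; case/mulmx1_unit: BB'.
rewrite /B' scalerA (_ : s * s ^- 2 = s^-1); last by field.
rewrite scalerBr addrAC subrr sub0r scale_scalar_mx gammaE mulKf //.
by rewrite -raddfN opprB.
Qed.

Lemma braid_tensor_skein (a b c d : index) :
  s * braid_inv k a b c d - s^-1 * braid k a b c d =
  (qpow k n (1 / 2) - qpow k n (- (1 / 2))) * ((a == c)%:R * (b == d)%:R).
Proof.
have /matrixP/(_ (enum_rank (a, b)) (enum_rank (c, d))) := braid_inv_skein.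
rewrite /braid_inv /braid -(natrM _ (a == c)) mulnb -xpair_eqE.
rewrite -(inj_eq enum_rank_inj) /=.
move: (invmx B) B => B' B; rewrite !mxE => ->.
by rewrite mulr_natr.
Qed.

End Braiding.

(** * Linearity of the contraction *)

Section SkeinPlace.
Variables (R : realType) (k : R[i]) (n : nat).
Local Notation s := (qpow k n (1 / (2 * n.+1%:R))).
Local Notation w := (qpow k n (1 / 2) - qpow k n (- (1 / 2))).

(** The labellings [x] and [y] may have any length: when one of them is too
    short to label the ends of the two strands, all three tensors vanish. *)
Lemma layer_skein (d : bool) (left right : layer) (x y : seq 'I_n.+1) :
  s * layer_tensor k (left ++ Crossing true d d :: right) x y
  - s^-1 * layer_tensor k (left ++ Crossing false d d :: right) x y
  = w * layer_tensor k (left ++ [:: Vertical d, Vertical d & right]) x y.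
Proof.
elim: left x y => [|p left IH] x y /=; last first.
  by rewrite [in RHS]mulrCA -IH; ring.
case: x y => [|c [|c' x]] [|a [|a' y]] /=;
  rewrite ?take0 ?drop0 ?(mulr0, mul0r, subrr) //.
by rewrite !mulrA -mulrBl braid_tensor_skein !mulrA.
Qed.

(** The sum runs over tuples whose length is computed from the layer; naming
    this length allows layers with equally many outgoing strands to be summed
    over the same type. *)
Lemma contraction_cons (N : nat) (l : layer) (K : seq layer)
    (x y : seq 'I_n.+1) :
  size (layer_out l) = N ->
  contraction k (l :: K) x y =
  \sum_(z : N.-tuple 'I_n.+1) layer_tensor k l x z * contraction k K z y.
Proof. by move=> <-. Qed.

Lemma contraction_linear (u v t : R[i]) (l1 l2 l3 : layer)
    (before after : seq layer) :
  size (layer_out l1) = size (layer_out l3) ->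
  size (layer_out l2) = size (layer_out l3) ->
  (forall x y : seq 'I_n.+1,
     u * layer_tensor k l1 x y - v * layer_tensor k l2 x y
     = t * layer_tensor k l3 x y) ->
  forall x y : seq 'I_n.+1,
  u * contraction k (before ++ l1 :: after) x y
  - v * contraction k (before ++ l2 :: after) x y
  = t * contraction k (before ++ l3 :: after) x y.
Proof.
move=> sz1 sz2 rel x y; elim: before x => [|l before IH] x.
  rewrite !cat0s (contraction_cons _ _ _ _ _ sz1).
  rewrite (contraction_cons _ _ _ _ _ sz2) (contraction_cons _ _ _ _ _ erefl).
  rewrite !mulr_sumr -sumrB; apply: eq_bigr => z _.
  by rewrite !mulrA -rel; ring.
rewrite /= !mulr_sumr -sumrB; apply: eq_bigr => z _.
by rewrite [in RHS]mulrCA -IH; ring.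
Qed.

End SkeinPlace.

(** * The skein relation *)

Lemma writhe_skein (Lp Lm L0 : link_diagram) :
  skein_triple Lp Lm L0 ->
  writhe Lp = writhe L0 + 1 /\ writhe Lm = writhe L0 - 1.
Proof.
case=> d [before [after [left [right [eLp eLm eL0]]]]].
rewrite /writhe eLp eLm eL0 !flatten_cat /= !cats0.
rewrite !(big_cat, big_cons, big_nil) /=.
by rewrite eqxx /=; split; ring.
Qed.

Lemma bracket_skein (R : realType) (k : R[i]) (n : nat)
    (Lp Lm L0 : link_diagram) :
  skein_triple Lp Lm L0 ->
  qpow k n (1 / (2 * n.+1%:R)) * bracket k n Lp
  - (qpow k n (1 / (2 * n.+1%:R)))^-1 * bracket k n Lm
  = (qpow k n (1 / 2) - qpow k n (- (1 / 2))) * bracket k n L0.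
Proof.
case=> d [before [after [left [right [eLp eLm eL0]]]]].
rewrite /bracket eLp eLm eL0.
apply: contraction_linear => [||x y]; last exact: layer_skein.
- by rewrite /layer_out !map_cat !flatten_cat.
- by rewrite /layer_out !map_cat !flatten_cat.
Qed.

(** In units of 1/(2(n+1)) the exponents satisfy (n+1)^2 = 1 + n(n+2). *)
Lemma framing_exponent (R : realType) (k : R[i]) (n : nat) :
  qpow k n (n.+1%:R / 2) =
  qpow k n (1 / (2 * n.+1%:R)) * framing_factor k n.
Proof.
rewrite /framing_factor -qpowD; congr qpow.
by rewrite -!natr1; field; rewrite natr1 pnatr_eq0.
Qed.

Theorem theorem3p12 (R : realType) (n : nat) (k : R[i])
    (Lp Lm L0 : link_diagram) :
  (1 <= n)%N ->
  k + n%:R + 1 != 0 ->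
  skein_triple Lp Lm L0 ->
  qpow k n (n.+1%:R / 2) * H k n Lp - qpow k n (- (n.+1%:R / 2)) * H k n Lm
  = (qpow k n (1 / 2) - qpow k n (- (1 / 2))) * H k n L0.
Proof.
move=> _ _ skein; rewrite qpowN framing_exponent /H.
have [-> ->] := writhe_skein _ _ _ skein.
have := bracket_skein _ k n _ _ _ skein.
have := qpow_neq0 R k n (1 / (2 * n.+1%:R)).
have : framing_factor k n != 0 := qpow_neq0 R k n _.
move: (qpow k n (1 / (2 * n.+1%:R))) (qpow k n (1 / 2) - _) => s w.
move: (framing_factor k n) => a a_neq0 s_neq0 brackets.
rewrite !opprD opprK !expfzDr // exprN1 expr1z.
rewrite (mulrCA w) -brackets.
by field; rewrite s_neq0.
Qed.
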